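(* Every group homomorphism $\mathcal{G}_\infty \to \mathrm{Homeo}_+(\mathbb{R})$ is trivial; that is, there is no nontrivial homomorphism $\mathcal{G}_\infty \to \mathrm{Homeo}_+(\mathbb{R})$.
   Context: $\mathrm{Homeo}_+(\mathbb{R})$ is the group (under composition) of orientation-preserving homeomorphisms of $\mathbb{R}$. The group of germs at infinity $\mathcal{G}_\infty$ is the set of equivalence classes of elements of $\mathrm{Homeo}_+(\mathbb{R})$ under the relation $f \sim g$ if $f$ and $g$ agree on some neighborhood $[x,\infty)$ of $\infty$; composition of homeomorphisms descends to a group operation on $\mathcal{G}_\infty$. Homomorphisms are abstract group homomorphisms (no continuity is assumed). *)

(* Defs.v *)
From HB Require Import structures.
From mathcomp Require Import all_boot all_order all_algebra generic_quotient.
From mathcomp Require Import all_classical all_reals.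
From mathcomp Require Import topology normedtype.

Set Implicit Arguments.
Unset Strict Implicit.
Unset Printing Implicit Defensive.

Import Order.TTheory GRing.Theory Num.Theory.
Import numFieldNormedType.Exports.

Local Open Scope ring_scope.
Local Open Scope quotient_scope.

(* A homeomorphism of the line preserves orientation exactly when it is
   increasing.  The inverse is a field of the record, but it is determined by
   the homeomorphism: see homeo_plus_eq. *)
Record homeo_plus (R : realType) := HomeoPlus {
  homeo_fun :> R -> R;
  homeo_inv : R -> R;
  homeo_funK : cancel homeo_fun homeo_inv;
  homeo_invK : cancel homeo_inv homeo_fun;
  homeo_fun_continuous : continuous homeo_fun;
  homeo_inv_continuous : continuous homeo_inv;
  homeo_fun_lt : {homo homeo_fun : x y / x < y}
}.

HB.instance Definition _ (R : realType) := gen_eqMixin (homeo_plus R).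
HB.instance Definition _ (R : realType) := gen_choiceMixin (homeo_plus R).

Section HomeoPlusGroup.
Variable R : realType.
Implicit Types f g h : homeo_plus R.

Lemma homeo_plus_eq f g : f =1 g -> f = g.
Proof.
case: f g => [f f' fK f'K fc f'c fl] [g g' gK g'K gc g'c gl] /= /funext fg.
subst g.
have e : f' = g' by apply/funext => x; rewrite -{1}(g'K x) fK.
subst g'; congr HomeoPlus; exact: Prop_irrelevance.
Qed.

Lemma homeo_plus_inv_lt f : {homo homeo_inv f : x y / x < y}.
Proof.
move=> x y xy; rewrite ltNge; apply/negP; rewrite le_eqVlt => /orP[/eqP e|].
  by move: xy; rewrite -(homeo_invK f x) -e homeo_invK ltxx.
move=> /(homeo_fun_lt f); rewrite !homeo_invK => /(lt_trans xy).
by rewrite ltxx.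
Qed.

Definition homeo_plus_one : homeo_plus R :=
  @HomeoPlus R idfun idfun (fun=> erefl) (fun=> erefl)
    (fun x => @cvg_id _ (nbhs x)) (fun x => @cvg_id _ (nbhs x))
    (fun _ _ xy => xy).

Definition homeo_plus_comp f g : homeo_plus R :=
  @HomeoPlus R (f \o g) (homeo_inv g \o homeo_inv f)
    (can_comp (homeo_funK f) (homeo_funK g))
    (can_comp (homeo_invK g) (homeo_invK f))
    (fun x => continuous_comp (@homeo_fun_continuous R g x)
                              (@homeo_fun_continuous R f (g x)))
    (fun x => continuous_comp (@homeo_inv_continuous R f x)
                              (@homeo_inv_continuous R g (homeo_inv f x)))
    (fun _ _ xy => homeo_fun_lt f (homeo_fun_lt g xy)).

Definition homeo_plus_inverse f : homeo_plus R :=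
  HomeoPlus (homeo_invK f) (homeo_funK f)
    (@homeo_inv_continuous R f) (@homeo_fun_continuous R f)
    (@homeo_plus_inv_lt f).

Lemma homeo_plus_compA : associative homeo_plus_comp.
Proof. by move=> f g h; apply: homeo_plus_eq. Qed.

Lemma homeo_plus_comp1f : left_id homeo_plus_one homeo_plus_comp.
Proof. by move=> f; apply: homeo_plus_eq. Qed.

Lemma homeo_plus_compf1 : right_id homeo_plus_one homeo_plus_comp.
Proof. by move=> f; apply: homeo_plus_eq. Qed.

Lemma homeo_plus_compVf :
  left_inverse homeo_plus_one homeo_plus_inverse homeo_plus_comp.
Proof. by move=> f; apply: homeo_plus_eq => x /=; rewrite homeo_funK. Qed.

Lemma homeo_plus_compfV :
  right_inverse homeo_plus_one homeo_plus_inverse homeo_plus_comp.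
Proof. by move=> f; apply: homeo_plus_eq => x /=; rewrite homeo_invK. Qed.

HB.instance Definition _ := isGroup.Build (homeo_plus R)
  homeo_plus_compA homeo_plus_comp1f homeo_plus_compf1
  homeo_plus_compVf homeo_plus_compfV.

Lemma homeo_plus_mulE f g x : (f * g)%g x = f (g x).
Proof. by []. Qed.

End HomeoPlusGroup.

Section Germs.
Variable R : realType.
Implicit Types f g h : homeo_plus R.

Definition germ_eq f g : bool :=
  `[< exists x : R, forall y, x <= y -> f y = g y >].

Lemma germ_eqP f g :
  reflect (exists x : R, forall y, x <= y -> f y = g y) (germ_eq f g).
Proof. exact: asboolP. Qed.

Lemma germ_eq_refl : reflexive germ_eq.
Proof. by move=> f; apply/germ_eqP; exists 0. Qed.

Lemma germ_eq_sym : symmetric germ_eq.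
Proof.
by move=> f g; apply/germ_eqP/germ_eqP => -[x fg]; exists x => y /fg ->.
Qed.

Lemma germ_eq_trans : transitive germ_eq.
Proof.
move=> g f h /germ_eqP[x fg] /germ_eqP[y gh]; apply/germ_eqP.
by exists (Num.max x y) => z; rewrite ge_max => /andP[/fg -> /gh].
Qed.

Canonical germ_eq_equiv :=
  EquivRel germ_eq germ_eq_refl germ_eq_sym germ_eq_trans.

Definition germ_infty : Type := {eq_quot germ_eq}.
HB.instance Definition _ := Choice.on germ_infty.
HB.instance Definition _ := EqQuotient.on germ_infty.

Definition germ_of (f : homeo_plus R) : germ_infty := \pi f.

Lemma germ_ofP f g :
  germ_of f = germ_of g <-> exists x : R, forall y, x <= y -> f y = g y.
Proof. by split=> [/eqmodP/germ_eqP|/germ_eqP/eqmodP]. Qed.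

Lemma germ_of_repr (a : germ_infty) : germ_of (repr a) = a.
Proof. exact: reprK. Qed.

(* Composition of chosen representatives; germ_mul_of and germ_inv_of show that
   the choice is irrelevant. *)
Definition germ_one : germ_infty := germ_of 1%g.
Definition germ_mul (a b : germ_infty) : germ_infty :=
  germ_of (repr a * repr b)%g.
Definition germ_inv (a : germ_infty) : germ_infty := germ_of (repr a)^-1%g.

Lemma germ_mul_of f g : germ_mul (germ_of f) (germ_of g) = germ_of (f * g)%g.
Proof.
have /germ_ofP[x fE] := germ_of_repr (germ_of f).
have /germ_ofP[y gE] := germ_of_repr (germ_of g).
apply/germ_ofP; exists (Num.max y (homeo_inv g x)) => z.
rewrite ge_max !homeo_plus_mulE => /andP[yz xz]; rewrite gE// fE//.
by rewrite -(homeo_invK g x) (ltW_homo (homeo_fun_lt g)).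
Qed.

Lemma germ_inv_of f : germ_inv (germ_of f) = germ_of f^-1%g.
Proof.
have /germ_ofP[x fE] := germ_of_repr (germ_of f).
apply/germ_ofP; exists (f x) => z xz.
have xz' : x <= homeo_inv f z.
  by rewrite -(homeo_funK f x) (ltW_homo (@homeo_plus_inv_lt _ f)).
by rewrite -[in LHS](homeo_invK f z) -fE// /= homeo_funK.
Qed.

Lemma germ_mulA : associative germ_mul.
Proof.
move=> a b c; rewrite -(germ_of_repr a) -(germ_of_repr b) -(germ_of_repr c).
by rewrite !germ_mul_of mulgA.
Qed.

Lemma germ_mul1 : left_id germ_one germ_mul.
Proof. by move=> a; rewrite -(germ_of_repr a) germ_mul_of mul1g. Qed.

Lemma germ_mulr1 : right_id germ_one germ_mul.
Proof. by move=> a; rewrite -(germ_of_repr a) germ_mul_of mulg1. Qed.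

Lemma germ_mulV : left_inverse germ_one germ_inv germ_mul.
Proof.
by move=> a; rewrite -(germ_of_repr a) germ_inv_of germ_mul_of mulVg.
Qed.

Lemma germ_mulrV : right_inverse germ_one germ_inv germ_mul.
Proof.
by move=> a; rewrite -(germ_of_repr a) germ_inv_of germ_mul_of mulgV.
Qed.

HB.instance Definition _ := isGroup.Build germ_infty
  germ_mulA germ_mul1 germ_mulr1 germ_mulV germ_mulrV.

Fact germ_of_morphM : {morph germ_of : f g / (f * g)%g}.
Proof. by move=> f g; rewrite -germ_mul_of. Qed.

HB.instance Definition _ :=
  isMultiplicative.Build (homeo_plus R) germ_infty germ_of germ_of_morphM.
HB.instance Definition _ :=
  Multiplicative_isUMagmaMorphism.Build (homeo_plus R) germ_infty germ_of erefl.

End Germs.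

(* Main.v *)
Require Import Defs.
From mathcomp Require Import all_boot all_order all_algebra.
From mathcomp Require Import all_classical all_reals.
From mathcomp Require Import topology normedtype.
From mathcomp Require Import zify ring lra.

Set Implicit Arguments.
Unset Strict Implicit.
Unset Printing Implicit Defensive.

Import Order.TTheory GRing.Theory Num.Theory.
Import numFieldNormedType.Exports.

Local Open Scope ring_scope.

(** The guiding principle is automatic continuity.  A homomorphism from the
    homeomorphism group of the line to a separable group has to be continuous;
    composing [phi] with the germ map gives one that kills all compactly
    supported homeomorphisms, and these are dense, so it has to be trivial.
    The proof below turns this principle into a finite combinatorial argument.

    Separability of the target enters through colourings.  Given [p < b] and
    [k], each homeomorphism of the target line is described by [k] rationals
    so coarsely that there are countably many descriptions, yet so precisely
    that a product of [k] quotients [a * b^-1] of germs with equal descriptions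
    moves [p] at most to [b] ([coarse_colouring]).  Hence a germ which, for
    every countable colouring, is a product of [k] quotients of germs of the
    same colour moves no point upwards, and acts trivially if the same holds
    for its inverse ([small_products_trivial]).

    On the side of germs, [k = 10] suffices for commutators [h g h^-1 g^-1] of
    homeomorphisms supported in a fixed sequence of intervals, the slots
    ([commutator_quotient_product]).  Two diagonal arguments prepare this.
    Slots are distributed among countably many owners, one for each colour; if
    each colour missed some prescription on its own slots, gluing these
    prescriptions would give a homeomorphism without a colour.  So for some
    colour [j], every prescription on the slots of [j] is met by a quotient [d],
    with no control over [d] on the other slots ([some_colour_fills]).
    Secondly, no countable family of integer sequences dominates all others, so
    some quotient [u] acts on successive blocks as positive powers of a given
    expanding map ([some_quotient_dominates]).  Taking an expansion of the
    slots of [j] onto large blocks, the conjugate of a [d] by [u] is prescribed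
    on everything that matters, its uncontrolled part being pushed away from
    the slots; in the commutator with another such quotient all uncontrolled
    parts cancel ([commutator_localized]).

    It remains to see that a normal subgroup of germs containing all these
    commutators is everything.  In the coordinate x / (1 - x) on the unit
    interval, doubling and squaring generate a copy of the relation
    [g e g^-1 = e^2], so [e] is a commutator that moves all points of the slots
    up ([slots_self_commutator]).  Four translates of it multiply to a germ
    above the identity, all germs above the identity are conjugate to a unit
    translation ([above_conj_translation]), and they generate the group
    ([eventually_above_trivial]). *)

(** * Constructing homeomorphisms of the line *)

Section HomeoFacts.
Variable R : realType.
Implicit Types (f g h : homeo_plus R) (x y : R).

Lemma homeoVK f x : (f^-1)%g (f x) = x.
Proof. exact: homeo_funK. Qed.

Lemma homeoKV f x : f ((f^-1)%g x) = x.
Proof. exact: homeo_invK. Qed.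

Lemma homeo_lt f x y : (f x < f y) = (x < y).
Proof.
apply/idP/idP => [fxy|]; last exact: homeo_fun_lt.
by have := homeo_fun_lt f^-1%g fxy; rewrite !homeoVK.
Qed.

Lemma homeo_le f x y : (f x <= f y) = (x <= y).
Proof. by rewrite !leNgt homeo_lt. Qed.

Lemma homeo_expE f n x : (f ^+ n)%g x = iter n f x.
Proof. by elim: n => // n IH; rewrite expgS /= -IH. Qed.

Lemma increasing_surj_continuous (u : R -> R) :
  {homo u : x y / x < y} -> (forall y, exists x, u x = y) -> continuous u.
Proof.
move=> ult usurj x; apply/cvgrPdist_lt => e e0.
have [a ua] := usurj (u x - e); have [b ub] := usurj (u x + e).
have ult' := leW_mono (le_mono ult).
have ax : a < x by rewrite -ult' ua; lra.
have xb : x < b by rewrite -ult' ub; lra.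
near=> t.
have ta : a < t by near: t; exact: lt_nbhsr.
have tb : t < b by near: t; exact: lt_nbhsl.
move: ta tb; rewrite -(ult' a) -(ult' t) ua ub ltr_norml => ? ?.
by apply/andP; split; lra.
Unshelve. all: by end_near.
Qed.

(** Reduces the construction of homeomorphisms to increasing surjections. *)
Lemma increasing_surj_homeo (u : R -> R) :
    {homo u : x y / x < y} -> (forall y, exists x, u x = y) ->
  exists h : homeo_plus R, forall x, h x = u x.
Proof.
move=> ult usurj.
have [w uw] := choice usurj.
have uinj : injective u := inc_inj (le_mono ult).
have wu : cancel u w by move=> x; apply: uinj; rewrite uw.
have wlt : {homo w : x y / x < y}.
  by move=> x y xy; rewrite -(leW_mono (le_mono ult)) !uw.
have wsurj y : exists x, w x = y by exists (u y); rewrite wu.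
exists (HomeoPlus wu uw (increasing_surj_continuous ult usurj)
  (increasing_surj_continuous wlt wsurj) ult).
by [].
Qed.

(** Since [Num.truncn] is 0 on the negative half-line, [F 0] governs everything
    below 1 and the pieces cover the line. *)
Lemma glue_homeo (F : nat -> homeo_plus R) :
    (forall n, F n n.+1%:R = F n.+1 n.+1%:R) ->
    (forall z, exists n, z <= F n n%:R) ->
  exists h : homeo_plus R, forall x, h x = F (Num.truncn x) x.
Proof.
move=> Fjoin Funb; apply: increasing_surj_homeo => [x y xy|z].
- have Fmono n p : F n n%:R <= F (n + p)%N (n + p)%:R.
    elim: p => [|p IH]; first by rewrite addn0.
    by apply: le_trans IH _; rewrite addnS -Fjoin homeo_le ler_nat.
  have [->|/eqP] := eqVneq (Num.truncn x) (Num.truncn y).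
    by rewrite homeo_lt.
  have := le_truncn (ltW xy); rewrite leq_eqVlt => /orP[/eqP ->//|nm _].
  have y0 : 0 <= y.
    rewrite leNgt; apply/negP => y0; move: nm.
    have /truncn0Pn -> // : ~~ (1 <= y) by lra.
  have /andP[my _] := truncn_itv y0.
  have xn : x < (Num.truncn x).+1%:R by exact: truncnS_gt.
  apply: (@lt_le_trans _ _ (F (Num.truncn x) (Num.truncn x).+1%:R)).
    by rewrite homeo_lt.
  rewrite Fjoin; apply: le_trans (Fmono _ (Num.truncn y - (Num.truncn x).+1)%N) _.
  by rewrite subnKC// homeo_le.
- case: (ltP z (F 0%N 0)) => [z0|z0].
    exists ((F 0%N)^-1%g z).
    suff -> : Num.truncn ((F 0%N)^-1%g z) = 0%N by rewrite homeoKV.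
    apply/truncn0Pn; rewrite -ltNge -(homeo_lt (F 0%N)) homeoKV.
    by apply: lt_trans z0 _; rewrite homeo_lt.
  have [N zN] : exists n, z < F n n%:R.
    have [n zn] := Funb z; exists n.+1; rewrite -Fjoin.
    by apply: le_lt_trans zn _; rewrite homeo_lt ltr_nat.
  have [n nz zn] : exists2 n, F n n%:R <= z & z < F n n.+1%:R.
    elim: N zN => [|N IH zN]; first by rewrite ltNge z0.
    by case: (ltP z (F N N%:R)) => [/IH//|Nz]; exists N; rewrite ?Fjoin.
  exists ((F n)^-1%g z).
  suff -> : Num.truncn ((F n)^-1%g z) = n by rewrite homeoKV.
  by apply: truncn_def; rewrite -(homeo_le (F n)) -(homeo_lt (F n)) homeoKV nz.
Qed.

Lemma affine_homeo (a b : R) : 0 < a ->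
  exists h : homeo_plus R, forall x, h x = a * x + b.
Proof.
move=> a0; apply: increasing_surj_homeo => [x y xy|y].
  by rewrite ltrD2r ltr_pM2l.
by exists ((y - b) / a); field; lra.
Qed.

Lemma translation_homeo (c : R) :
  exists h : homeo_plus R, forall x, h x = x + c.
Proof.
have [h hE] := affine_homeo c ltr01.
by exists h => x; rewrite hE mul1r.
Qed.

Lemma interpolate_homeo (s t : nat -> R) :
    (forall n, s n < s n.+1) -> (forall z, exists n, z <= s n) ->
    (forall n, t n < t n.+1) -> (forall z, exists n, z <= t n) ->
  exists h : homeo_plus R, forall n, h (s n) = t n.
Proof.
have from_nat (r : nat -> R) : (forall n, r n < r n.+1) ->
    (forall z, exists n, z <= r n) ->
    exists h : homeo_plus R, forall n, h n%:R = r n.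
  move=> rlt runb.
  have slope n : 0 < r n.+1 - r n by rewrite subr_gt0.
  have [F FE] := choice (fun n =>
    affine_homeo (r n - (r n.+1 - r n) * n%:R) (slope n)).
  have Fl n : F n n%:R = r n by rewrite FE; ring.
  have Fr n : F n n.+1%:R = r n.+1 by rewrite FE -[n.+1]addn1 natrD; ring.
  have [|z|h hE] := @glue_homeo F; first by move=> n; rewrite Fl Fr.
    by have [n zn] := runb z; exists n; rewrite Fl.
  by exists h => n; rewrite hE natrK Fl.
move=> slt sunb tlt tunb.
have [p pE] := from_nat s slt sunb; have [q qE] := from_nat t tlt tunb.
by exists (q * p^-1)%g => n; rewrite homeo_plus_mulE -pE homeoVK qE.
Qed.

End HomeoFacts.

(** * Germs above the identity *)

Section GroupMorphisms.
Variables (G H : groupType) (phi : {multiplicative G -> H}).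

Lemma multiplicative1 : phi 1%g = 1%g.
Proof. by apply: (mulgI (phi 1%g)); rewrite -gmulfM !mulg1. Qed.

Lemma multiplicativeV a : phi a^-1%g = (phi a)^-1%g.
Proof. by apply: (mulgI (phi a)); rewrite -gmulfM !mulgV multiplicative1. Qed.

End GroupMorphisms.

Section PositiveGerms.
Variable R : realType.
Implicit Types (f g h : homeo_plus R) (x y : R).

Definition eventually_above f := exists x0, forall x, x0 <= x -> x < f x.

Lemma iter_unbounded f (x0 : R) : (forall x, x0 <= x -> x < f x) ->
  forall z, exists n, z <= iter n f x0.
Proof.
move=> fup z; apply: contrapT => /forallNP bounded.
have x0_iter n : x0 <= iter n f x0.
  by elim: n => //= n IH; exact/(le_trans IH)/ltW/fup.
pose E : classical_sets.set R := fun y => exists n, iter n f x0 = y.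
have supE : has_sup E.
  split; first by exists x0; exists 0%N.
  exists z => _ [n <-]; apply: ltW; rewrite ltNge.
  by apply/negP; exact: bounded.
have ubE n : iter n f x0 <= sup E by apply: ub_le_sup; [case: supE|exists n].
have fs : (f^-1)%g (sup E) < sup E.
  by rewrite -(homeo_lt f) homeoKV; apply: fup; exact: ubE 0%N.
have eps : 0 < sup E - (f^-1)%g (sup E) by rewrite subr_gt0.
have [_ [n <-]] := sup_adherent eps supE.
rewrite opprB addrC subrK -(homeo_lt f) homeoKV => lt_sup.
by have := ubE n.+1; rewrite leNgt lt_sup.
Qed.

(** The usual conjugacy: an affine map carries the fundamental domain [0, 1]
    of the translation to the fundamental domain [x0, f x0] of [f], and the
    iterates [f^n A tau^-n] glue to a conjugacy.  Below [x0] nothing needs to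
    match, as only germs are compared. *)
Lemma above_conj_translation f (tau : homeo_plus R) :
    (forall x, tau x = x + 1) -> eventually_above f ->
  exists h, germ_of f = (germ_of h * germ_of tau * (germ_of h)^-1)%g.
Proof.
move=> tauE [x0 fup].
have slope : 0 < f x0 - x0 by rewrite subr_gt0 fup.
have [A AE] := affine_homeo x0 slope.
have tauV n x : (tau ^- n)%g x = x - n%:R.
  apply: (can_inj (homeoVK (tau ^+ n)%g)); rewrite homeoKV homeo_expE.
  elim: n => [|n IH]; first by rewrite subr0.
  by rewrite iterSr tauE -addn1 natrD opprD addrA subrK.
pose F n := (f ^+ n * A * tau ^- n)%g.
have FE n x : F n x = iter n f (A (x - n%:R)).
  by rewrite /F !homeo_plus_mulE homeo_expE tauV.
have A0 : A 0 = x0 by rewrite AE mulr0 add0r.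
have A1 : A 1 = f x0 by rewrite AE mulr1 subrK.
have [n|z|h hE] := @glue_homeo R F.
- by rewrite !FE subrr -natr1 [_ + 1]addrC addrK A0 A1 iterSr.
- by have [n zn] := iter_unbounded fup z; exists n; rewrite FE subrr A0.
exists h.
suff -> : germ_of f = germ_of (h * tau * h^-1)%g by rewrite !gmulfM gmulfV.
apply/germ_ofP.
exists (h 0) => y hy.
rewrite !homeo_plus_mulE tauE.
set x := (h^-1)%g y; have yE : y = h x by rewrite homeoKV.
have x0' : 0 <= x by rewrite -(homeo_le h) -yE.
have -> : h (x + 1) = f (h x); last by rewrite yE.
(* Moving from [x] to [x + 1] changes piece, from [F n] to [F n.+1]. *)
have trS : Num.truncn (x + 1) = (Num.truncn x).+1.
  have /andP[xl xr] := truncn_itv x0'.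
  by apply: truncn_def; rewrite -!natr1 lerD2r ltrD2r xl natr1.
rewrite !hE trS !FE -natr1 /=; congr (f (iter _ _ (A _))); ring.
Qed.

(** Germs above the identity form one conjugacy class, and any germ [g] is a
    quotient of two of them: if [b] exceeds both the identity and [g^-1] by 1,
    then [b] and [g b] are above the identity. *)
Lemma eventually_above_trivial (G : groupType)
    (phi : {multiplicative germ_infty R -> G}) f :
  eventually_above f -> phi (germ_of f) = 1%g -> forall a, phi a = 1%g.
Proof.
move=> fup phif.
have [tau tauE] := translation_homeo (1 : R).
have phi_conj h g : phi (germ_of h * germ_of g * (germ_of h)^-1)%g = 1%g <->
    phi (germ_of g) = 1%g.
  rewrite !gmulfM multiplicativeV; split => [/divg1_eq|->].
    by rewrite -[RHS]mulg1 => /mulgI.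
  by rewrite mulg1 mulgV.
have phi_above g : eventually_above g -> phi (germ_of g) = 1%g.
  move=> gup; have [h ->] := above_conj_translation tauE gup; apply/phi_conj.
  by have [h' e] := above_conj_translation tauE fup; apply/(phi_conj h'); rewrite -e.
move=> a; rewrite -(germ_of_repr a); move: (repr a) => {a} g.
have [b bE] : exists b : homeo_plus R, forall x,
    b x = Num.max x ((g^-1)%g x) + 1.
  apply: increasing_surj_homeo => [x y xy|y].
    rewrite ltrD2r lt_max !gt_max homeo_lt xy andbT; apply/orP.
    case: (ltP ((g^-1)%g x) y) => yx; [by left|right].
    by rewrite (lt_trans (lt_le_trans xy yx))// homeo_lt.
  exists (Num.min (y - 1) (g (y - 1))).
  case: (leP (y - 1) (g (y - 1))) => [le1|/ltW le2].
    rewrite max_l ?subrK//.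
    by rewrite -(homeo_le g) homeoKV.
  by rewrite homeoVK max_r ?subrK.
have b_above : eventually_above b.
  by exists 0 => x _; rewrite bE ltr_pwDr// le_max lexx.
have gb_above : eventually_above (g * b)%g.
  exists 0 => x _; rewrite homeo_plus_mulE -{1}(homeoKV g x) homeo_lt bE.
  by rewrite ltr_pwDr// le_max lexx orbT.
have := phi_above _ gb_above.
by rewrite !gmulfM (phi_above _ b_above) mulg1.
Qed.

End PositiveGerms.

(** * Quotients of elements of equal colour *)

Section QuotientProducts.
Variables (G : groupType) (T : Type) (chi : G -> T).

Definition colour_quotient (x : G) :=
  exists a b, chi a = chi b /\ x = (a * b^-1)%g.

Fixpoint quotient_product (k : nat) (x : G) : Prop :=
  if k is k'.+1 then
    exists a y, [/\ colour_quotient a, quotient_product k' y & x = (a * y)%g]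
  else x = 1%g.

Lemma colour_quotientV x : colour_quotient x -> colour_quotient x^-1%g.
Proof.
by move=> [a [b [e ->]]]; exists b, a; split => //; rewrite invgM invgK.
Qed.

Lemma quotient_productS k a x :
  colour_quotient a -> quotient_product k x -> quotient_product k.+1 (a * x)%g.
Proof. by exists a, x. Qed.

Lemma quotient_product1 a : colour_quotient a -> quotient_product 1 a.
Proof. by exists a, 1%g; split => //; rewrite mulg1. Qed.

End QuotientProducts.

Section Supports.
Variable R : realType.
Implicit Types (f g h : homeo_plus R) (A B : R -> Prop) (x y : R).

Definition supported A f := forall x, ~ A x -> f x = x.

Lemma supported_stable A f x : supported A f -> A (f x) <-> A x.
Proof.
move=> fA; split => Ax; apply: contrapT => nA; have e := fA _ nA.
  by apply: nA; rewrite -e.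
by apply: nA; move: e => /(congr1 f^-1%g); rewrite !homeoVK => ->.
Qed.

Lemma supportedS A B f : (forall x, A x -> B x) -> supported A f ->
  supported B f.
Proof. by move=> AB fA x nB; apply: fA => /AB. Qed.

Lemma supportedV A f : supported A f -> supported A f^-1%g.
Proof. by move=> fA x nA; rewrite -{1}(fA x nA) homeoVK. Qed.

Lemma supported_conj A B f g : (forall x, A (g x) -> B x) -> supported A f ->
  supported B (g^-1 * f * g)%g.
Proof.
move=> AB fA x nB; rewrite !homeo_plus_mulE fA ?homeoVK//.
by move/AB.
Qed.

(** The uncontrolled parts of [d] and [e] cancel: [d] can differ from [h] only
    inside [B], where [e] is the identity off [A]; outside [B], where [e] is
    arbitrary, [d] is the identity. *)
Lemma commutator_localized A B (d e h g : homeo_plus R) :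
    (forall x, A x -> B x) -> supported A h -> supported A g -> supported B d ->
    (forall x, A x -> d x = h x) -> (forall x, B x -> e x = g x) ->
  (d * e * d^-1 * e^-1 = h * g * h^-1 * g^-1)%g.
Proof.
move=> AB hA gA dB dh eg.
(* [d] permutes [A] because it coincides there with [h], which does. *)
have dA x : A (d x) <-> A x.
  split=> [Adx|Ax]; last by rewrite dh // (supported_stable _ hA).
  have Aw : A ((h^-1)%g (d x)).
    by rewrite (supported_stable _ (supportedV hA)).
  have e1 : d ((h^-1)%g (d x)) = d x by rewrite dh // homeoKV.
  by rewrite -(homeoVK d x) -e1 homeoVK.
have gB := supportedS AB gA.
have eB x : B (e x) <-> B x.
  split=> [Bex|Bx]; last by rewrite eg // (supported_stable _ gB).
  have Bw : B ((g^-1)%g (e x)).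
    by rewrite (supported_stable _ (supportedV gB)).
  have e1 : e ((g^-1)%g (e x)) = e x by rewrite eg // homeoKV.
  by rewrite -(homeoVK e x) -e1 homeoVK.
set z := (h * g * h^-1 * g^-1)%g.
have zA : supported A z.
  move=> x nA; rewrite /z !homeo_plus_mulE.
  rewrite (supportedV gA)// (supportedV hA)// gA // hA //.
have zE x : z (g (h x)) = h (g x) by rewrite /z !homeo_plus_mulE !homeoVK.
clearbody z; suff e1 : (d * e = z * e * d)%g by rewrite e1 !mulgK.
apply: homeo_plus_eq => y; rewrite !homeo_plus_mulE.
have [By|nBy] := pselect (B y); last first.
  rewrite (dB y)// dB ?eB// zA// => /AB.
  by rewrite eB.
rewrite !eg // ?(supported_stable _ dB)//.
have [Ay|nAy] := pselect (A y).
  by rewrite !dh ?(supported_stable _ gA).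
by rewrite (gA y)// gA ?dA// zA ?dA.
Qed.

End Supports.

(** * Quotients with prescribed behaviour on slots *)

Section Slots.
Variable R : realType.
Implicit Types (f g h : homeo_plus R) (x y : R) (m k : nat).

(** The slots are spaced so that the natural numbers, and the intervals of
    length 2 between consecutive slots, stay pointwise fixed: block boundaries
    can be placed there. *)
Definition in_slot m x := (3 * m).+1%:R < x < (3 * m).+2%:R.
Definition slots x := exists m, in_slot m x.
(** The 2-adic valuation gives each [j] infinitely many slots, exactly one of
    them in each block of [2 ^ j.+1] consecutive slots. *)
Definition owner m := logn 2 m.+1.

Lemma in_slot_truncn m x : in_slot m x -> Num.truncn x = (3 * m).+1.
Proof. by move=> /andP[/ltW ? ?]; apply/truncn_def/andP. Qed.

Lemma nat_notin_slots k : ~ slots k%:R.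
Proof. by move=> [m /andP[]]; rewrite !ltr_nat => ? ?; lia. Qed.

Lemma owner_slot j i : owner (2 ^ j * i.*2.+1).-1 = j.
Proof.
rewrite /owner prednK ?muln_gt0 ?expn_gt0//.
rewrite lognM ?expn_gt0// pfactorK// (@logn_coprime 2 i.*2.+1) ?addn0//.
by rewrite coprime2n /= odd_double.
Qed.

Variable chi : germ_infty R -> nat.

(** Diagonal argument: if for each colour [j] some [h j] were not realised on
    the slots of [j] by a homeomorphism of colour [j], the homeomorphism equal
    to [h j] on the slots of [j], for all [j] at once, would have no colour.
    Dividing by a realisation of the identity turns the homeomorphism of colour
    [j] into a quotient. *)
Lemma some_colour_fills : exists j, forall h, supported slots h ->
  exists d, [/\ colour_quotient chi (germ_of d), supported slots d &
    forall m x, owner m = j -> in_slot m x -> d x = h x].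
Proof.
suff [j jP] : exists j, forall h, supported slots h ->
    exists f, [/\ chi (germ_of f) = j, supported slots f &
      forall m x, owner m = j -> in_slot m x -> f x = h x].
  exists j => h hs; have [f [fj fs fh]] := jP h hs.
  have [g [gj gs g1]] := jP 1%g (fun _ _ => erefl).
  exists (f * g^-1)%g; split.
  - by exists (germ_of f), (germ_of g); rewrite fj gj gmulfM gmulfV.
  - by move=> x ns; rewrite homeo_plus_mulE (supportedV gs)// fs.
  - move=> m x mj xm; rewrite homeo_plus_mulE.
    by rewrite -{1}[x](g1 _ _ mj xm) homeoVK (fh m).
apply: contrapT => /forallNP bad.
have /choice[h hP] : forall j, exists h, supported slots h /\
    forall f, chi (germ_of f) = j -> supported slots f ->
      ~ forall m x, owner m = j -> in_slot m x -> f x = h x.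
  move=> j; apply: contrapT => /forallNP noh; apply: (bad j) => h hs.
  apply: contrapT => /forallNP nof; apply: (noh h); split => // f fj fs fh.
  by apply: (nof f); split.
have hN j k : h j k%:R = k%:R by apply: (hP j).1; exact: nat_notin_slots.
have [k|z|f fE] := @glue_homeo R (fun k => h (owner (k %/ 3)%N)).
- by rewrite !hN.
- exists (Num.truncn z).+1; rewrite hN; exact/ltW/truncnS_gt.
apply: ((hP (chi (germ_of f))).2 f) => //.
  by move=> x ns; rewrite fE (hP _).1.
move=> m x <- /in_slot_truncn xm; rewrite fE xm; congr (h (owner _) x); lia.
Qed.

(** For [s : nat -> nat] let [V s] act on the [i]-th block of length [L] as
    [v ^+ s i].  Among the [V s], choose a representative [V (t c)] of each
    colour [c] that occurs; the sequence [s] outgrows every [t c], and has the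
    colour of one of them.  The quotient of the two is [u]. *)
Lemma some_quotient_dominates (L : nat) (v : homeo_plus R) : (0 < L)%N ->
    (forall i, v (L * i)%:R = (L * i)%:R) ->
  exists u, colour_quotient chi (germ_of u) /\
    forall x, exists r, u x = iter r.+1 v x.
Proof.
move=> L0 vL.
have /choice[V VE] : forall s : nat -> nat, exists h : homeo_plus R,
    forall x, h x = iter (s (Num.truncn x %/ L)%N) v x.
  move=> s; pose F k := (v ^+ s (k %/ L)%N)%g.
  have FE k x : F k x = iter (s (k %/ L)%N) v x by rewrite homeo_expE.
  have vLn n i : iter n v (L * i)%:R = (L * i)%:R.
    by elim: n => //= n ->.
  have [k|z|h hE] := @glue_homeo R F.
  - have [/dvdnP[i ki]|nd] := boolP (L %| k.+1)%N.
      by rewrite ki mulnC !FE !vLn.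
    rewrite !FE; congr (iter (s _) v _).
    by rewrite divnS// (negbTE nd).
  - exists (L * (Num.truncn z).+1)%N; rewrite FE vLn.
    apply/ltW/(lt_le_trans (truncnS_gt z)); rewrite ler_nat; exact: leq_pmull.
  by exists h => x; rewrite hE FE.
have /choice[t tP] : forall c, exists t, forall s,
    chi (germ_of (V s)) = c -> chi (germ_of (V t)) = c.
  move=> c; have [[t tc]|none] := pselect (exists t, chi (germ_of (V t)) = c).
    by exists t.
  by exists id => s sc; case: none; exists s.
pose s i := (\sum_(c < i.+1) t c i)%N.+1.
pose c := chi (germ_of (V s)).
have tc : chi (germ_of (V (t c))) = c by exact: (tP c s).
(* [s] exceeds [t c] from index [c] on only; correcting finitely many
   terms leaves the germ, hence the colour, unchanged. *)
pose s' i := maxn (s i) (t c i).+1.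
have ss' i : (c <= i)%N -> s' i = s i.
  move=> ci; apply/maxn_idPl; rewrite ltnS.
  by rewrite (bigD1 (Ordinal (ci : (c < i.+1)%N)))//= leq_addr.
have s'c : germ_of (V s') = germ_of (V s).
  apply/germ_ofP; exists (L * c)%:R => x Lx; rewrite !VE ss'//.
  have x0 : 0 <= x by apply: le_trans Lx.
  by rewrite leq_divRL// mulnC truncn_ge_nat.
exists (V s' * (V (t c))^-1)%g; split.
  exists (germ_of (V s')), (germ_of (V (t c))).
  by rewrite gmulfM gmulfV; split; first by rewrite tc s'c.
move=> x; rewrite homeo_plus_mulE; set y := ((V (t c))^-1)%g x.
have -> : x = V (t c) y by rewrite homeoKV.
rewrite !VE; set b := (_ %/ _)%N; exists (s' b - t c b).-1.
by rewrite -iterD; congr iter; rewrite /s'; lia.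
Qed.

End Slots.

(** * Commutators are products of ten quotients *)

Section Commutators.
Variable R : realType.
Implicit Types (f g h : homeo_plus R) (x y : R).

(** The [i]-th block is [6 P i, 6 P (i + 1)].  When [P = 2 ^ j], the unit
    interval that is stretched is the slot of owner [j] in the block, and its
    image covers all the slots of the block. *)
Lemma expanding_homeo (P : nat) : (0 < P)%N ->
  exists v : homeo_plus R, forall i,
    [/\ v (6 * P * i)%:R = (6 * P * i)%:R,
        v (6 * P * i + (3 * P - 2))%:R = (6 * P * i + 1)%:R &
        v (6 * P * i + (3 * P - 1))%:R = (6 * P * i + (6 * P - 1))%:R].
Proof.
move=> P0.
(* The three points of each block where [v] is prescribed, and likewise
   their images, are listed as one sequence with index [3 i + r]. *)
pose off (b c r : nat) := if r is r'.+1 then (if r' is _.+1 then c else b) else 0%N.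
pose pt b c n := (6 * P * (n %/ 3) + off b c (n %% 3))%N.
have ptE b c i r : (r < 3)%N -> pt b c (3 * i + r)%N = (6 * P * i + off b c r)%N.
  move=> r3; rewrite /pt.
  have -> : ((3 * i + r) %/ 3)%N = i by lia.
  by have -> : ((3 * i + r) %% 3)%N = r by lia.
have pt_lt b c n : (0 < b < c)%N -> (c < 6 * P)%N -> (pt b c n < pt b c n.+1)%N.
  move=> bc c6; rewrite (divn_eq n 3) mulnC.
  set i := (n %/ 3)%N; have : (n %% 3 < 3)%N by exact: ltn_pmod.
  case: (n %% 3)%N => [|[|[|//]]] _; rewrite ptE//=.
  - have -> : (3 * i + 0).+1 = (3 * i + 1)%N by lia.
    by rewrite ptE//=; lia.
  - have -> : (3 * i + 1).+1 = (3 * i + 2)%N by lia.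
    by rewrite ptE//=; lia.
  - have -> : (3 * i + 2).+1 = (3 * i.+1 + 0)%N by lia.
    by rewrite ptE//=; nia.
have pt_unb b c (z : R) : exists n, z <= (pt b c n)%:R.
  exists (3 * (Num.truncn z).+1 + 0)%N; rewrite ptE//=.
  apply/ltW/(lt_le_trans (truncnS_gt z)); rewrite ler_nat addn0; apply: leq_pmull; lia.
have [||||v vE] := @interpolate_homeo R
  (fun n => (pt (3 * P - 2)%N (3 * P - 1)%N n)%:R)
  (fun n => (pt 1%N (6 * P - 1)%N n)%:R).
- by move=> n; rewrite ltr_nat; apply: pt_lt; lia.
- exact: pt_unb.
- by move=> n; rewrite ltr_nat; apply: pt_lt; lia.
- exact: pt_unb.
exists v => i; split.
- by have := vE (3 * i + 0)%N; rewrite !ptE//= !addn0.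
- by have := vE (3 * i + 1)%N; rewrite !ptE.
- by have := vE (3 * i + 2)%N; rewrite !ptE.
Qed.

(** Let [A] be the union of the slots of [j] and [B] the union of the blocks
    shrunk by 1 at both ends, so that [B] contains all slots.  The quotient [u]
    satisfies u^-1(B) ⊆ A, so conjugating by [u] turns [h] and [g] into [h1] and
    [g1] supported in [A].  On [A], a quotient [d] equals [h1]; on the larger
    set [B], the conjugate [u e u^-1] equals [g1], provided [e] equals
    [u^-1 g1 u] on [A].  The commutator of the two is that of [h1] and [g1];
    conjugating back by [u] gives the count 10 = 2 + 2 (1 + 3). *)
Lemma commutator_quotient_product (chi : germ_infty R -> nat) h g :
    supported (@slots R) h -> supported (@slots R) g ->
  quotient_product chi 10 (germ_of (h * g * h^-1 * g^-1)%g).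
Proof.
move=> hs gs.
have [j fill] := some_colour_fills chi.
set P := (2 ^ j)%N; have P0 : (0 < P)%N by rewrite expn_gt0.
pose m i := (P * i.*2.+1).-1.
have mE i : (3 * m i).+1 = (6 * P * i + (3 * P - 2))%N by rewrite /m; nia.
have mE' i : (3 * m i).+2 = (6 * P * i + (3 * P - 1))%N by rewrite mE; lia.
have [v vE] := expanding_homeo P0.
pose A x := exists i, in_slot (m i) x.
pose B x := exists i, (6 * P * i + 1)%:R < x < (6 * P * i + (6 * P - 1))%:R.
have vBA x : B (v x) -> A x.
  move=> [i]; have [_ <- <-] := vE i; rewrite !homeo_lt -mE -mE' => xi.
  by exists i.
have slotsB x : slots x -> B x.
  move=> [k /andP[kx xk]]; exists (k %/ (2 * P))%N.
  have := divn_eq k (2 * P); have : (k %% (2 * P) < 2 * P)%N by rewrite ltn_pmod; lia.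
  set i := (k %/ _)%N; set r := (k %% _)%N => r2 ke.
  apply/andP; split.
    by apply: le_lt_trans kx; rewrite ler_nat; nia.
  by apply: lt_le_trans xk _; rewrite ler_nat; nia.
have Aslots x : A x -> slots x by move=> [i ?]; exists (m i).
have AB x : A x -> B x by move=> /Aslots/slotsB.
have L0 : (0 < 6 * P)%N by lia.
have [u [uq uE]] := some_quotient_dominates chi L0 (fun i => let: And3 e _ _ := vE i in e).
have uBA x : B (u x) -> A x.
  have [r ->] := uE x.
  by elim: r => [|r IH] /= /vBA // /AB.
have conjA f : supported (@slots R) f -> supported A (u^-1 * f * u)%g.
  by apply: supported_conj => x /slotsB/uBA.
set h1 := (u^-1 * h * u)%g; set g1 := (u^-1 * g * u)%g.
have h1A : supported A h1 by exact: conjA.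
have g1A : supported A g1 by exact: conjA.
set g2 := (u^-1 * g1 * u)%g.
have g2A : supported A g2 by apply: conjA; exact: supportedS g1A.
have [d [dq ds dh]] := fill _ (supportedS Aslots h1A).
have [e [eq es eg]] := fill _ (supportedS Aslots g2A).
have ownerA i : owner (m i) = j by exact: owner_slot.
have comm : (d * (u * e * u^-1) * d^-1 * (u * e * u^-1)^-1
             = h1 * g1 * h1^-1 * g1^-1)%g.
  apply: (commutator_localized AB) => //; first exact: supportedS ds.
    by move=> x [i xi]; rewrite (dh (m i)).
  move=> x Bx; rewrite !homeo_plus_mulE.
  have [i xi] : A ((u^-1)%g x) by apply: uBA; rewrite homeoKV.
  by rewrite (eg (m i))// /g2 !homeo_plus_mulE !homeoKV.
have -> : (h * g * h^-1 * g^-1 = u * (d * (u * e * u^-1) * d^-1 *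
    (u * e * u^-1)^-1) * u^-1)%g.
  by rewrite comm /h1 /g1 !invgM !invgK !mulgA mulgV mul1g !mulgK.
rewrite !invgM !invgK -!mulgA !gmulfM !gmulfV.
have Vq := @colour_quotientV _ _ chi.
do 9! [apply: quotient_productS; first by [|exact: Vq]].
by apply: quotient_product1; exact: Vq.
Qed.

End Commutators.

(** * Colourings given by an action on the line *)

Section Actions.
Variables (R : realType) (G : groupType).
Variable phi : {multiplicative G -> homeo_plus R}.

(** Cut [p, b] at equidistant points [y 0 = p, ..., y k = b] and colour [a] by
    rationals [q i] that it maps between [y i] and [y i.+1].  If [a] and [c]
    share these rationals then [c^-1] maps [y i] below [q i], and [a] maps
    [q i] below [y i.+1], so a quotient climbs at most one step. *)
Lemma coarse_colouring (p b : R) (k : nat) : (0 < k)%N -> p < b ->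
  exists chi : G -> nat, forall x, quotient_product chi k x -> phi x p <= b.
Proof.
move=> k0 pb.
pose y (i : nat) := p + (b - p) / k%:R * i%:R.
have step : 0 < (b - p) / k%:R by rewrite divr_gt0 ?ltr0n// subr_gt0.
have ylt i : y i < y i.+1 by rewrite /y -natr1; lra.
have /choice[q qP] : forall a, exists q : nat -> rat,
    forall i, y i < phi a (ratr (q i)) < y i.+1.
  move=> a; suff /choice[q qP] : forall i, exists r : rat,
      y i < phi a (ratr r) < y i.+1 by exists q.
  move=> i; have lti : (phi a)^-1%g (y i) < (phi a)^-1%g (y i.+1).
    by rewrite homeo_lt.
  have [r] := rat_in_itvoo lti.
  rewrite in_itv /= => /andP[yr ry]; exists r.
  by rewrite -{1}(homeoKV (phi a) (y i)) -(homeoKV (phi a) (y i.+1)) !homeo_lt yr.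
exists (fun a => pickle (mkseq (q a) k)).
set chi := fun a => _.
have quotient_step x i : (i < k)%N -> colour_quotient chi x ->
    phi x (y i) < y i.+1.
  move=> ik [a [c [/(pcan_inj pickleK) qac ->]]].
  have qi : q a i = q c i.
    by have := congr1 (fun s => nth 0 s i) qac; rewrite !nth_mkseq.
  have /andP[cl _] := qP c i; have /andP[_ ar] := qP a i.
  rewrite gmulfM multiplicativeV homeo_plus_mulE; apply: lt_trans ar.
  by rewrite homeo_lt qi -(homeo_lt (phi c)) homeoKV.
have reach i x : (i <= k)%N -> quotient_product chi i x -> phi x p <= y i.
  elim: i x => [|i IH] x ik /=.
    by move=> ->; rewrite multiplicative1 /y mulr0 addr0.
  move=> [a [z [aq zq ->]]]; rewrite gmulfM homeo_plus_mulE.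
  by apply: le_trans (ltW (quotient_step _ _ ik aq)); rewrite homeo_le IH// ltnW.
move=> x /(reach _ _ (leqnn k)) /le_trans -> //.
by rewrite /y mulfVK ?pnatr_eq0 -?lt0n// addrC subrK.
Qed.

(** A point [p] moved up by [x] is separated from its image by some [b], which
    contradicts the colouring given by [p] and [b]. *)
Lemma small_products_trivial (k : nat) (x : G) : (0 < k)%N ->
    (forall chi : G -> nat, quotient_product chi k x) ->
    (forall chi : G -> nat, quotient_product chi k x^-1%g) -> phi x = 1%g.
Proof.
move=> k0 xk xVk.
have fixle z p : (forall chi : G -> nat, quotient_product chi k z) ->
    phi z p <= p.
  move=> zk; rewrite leNgt; apply/negP => pz.
  have pm : p < (p + phi z p) / 2 by lra.
  have [chi /(_ _ (zk chi))] := coarse_colouring k0 pm; lra.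
apply: homeo_plus_eq => p; apply: le_anti; rewrite fixle//=.
by rewrite -(homeo_le (phi x)^-1%g) homeoVK -multiplicativeV fixle.
Qed.

End Actions.

(** * An upward moving commutator *)

Section SelfCommutator.
Variable R : realType.
Implicit Types (f g h : homeo_plus R) (x y t : R).

Lemma unit_interval_homeo (u w : R -> R) :
    (forall x, 0 < x < 1 -> 0 < u x < 1) ->
    (forall x, 0 < x < 1 -> 0 < w x < 1) ->
    (forall x, 0 < x < 1 -> u (w x) = x) ->
    (forall x y, 0 < x -> x < y -> y < 1 -> u x < u y) ->
  exists h, supported (fun x => 0 < x < 1) h /\
    forall x, 0 < x < 1 -> h x = u x.
Proof.
move=> u01 w01 uw ult.
have [x y xy|y|h hE] :=
    @increasing_surj_homeo R (fun x => if 0 < x < 1 then u x else x).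
- case: ifPn => x01; case: ifPn => y01 //.
  + by apply: ult => //; [case/andP: x01|case/andP: y01].
  + have /andP[_ u1] := u01 x x01; move: x01 y01 => /andP[? ?].
    by rewrite negb_and -!leNgt => /orP[] ?; lra.
  + have /andP[u0 _] := u01 y y01; move: y01 x01 => /andP[? ?].
    by rewrite negb_and -!leNgt => /orP[] ?; lra.
- have [y01|/negbTE y01] := boolP (0 < y < 1); last by exists y; rewrite y01.
  by exists (w y); rewrite w01 ?uw.
exists h; split=> x x01; rewrite hE; first by rewrite (negbTE (introN idP x01)).
by rewrite x01.
Qed.

(** In the coordinate y = x / (1 - x), which identifies the unit interval with
    the positive half-line, [e] is y |-> 2 y and [g] is y |-> y ^ 2, whence
    [g e g^-1] is y |-> 4 y. *)
Lemma unit_interval_self_commutator : exists e g : homeo_plus R,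
  [/\ supported (fun x => 0 < x < 1) e, supported (fun x => 0 < x < 1) g,
      forall x, 0 < x < 1 -> x < e x & (g * e = e * e * g)%g].
Proof.
have [x x01|x x01|x x01|x y x0 xy y1|e [es eE]] :=
  @unit_interval_homeo (fun x => 2 * x / (1 + x)) (fun x => x / (2 - x)).
- have [x0 x1] := andP x01.
  by rewrite divr_gt0 ?ltr_pdivrMr; lra.
- have [x0 x1] := andP x01.
  by rewrite divr_gt0 ?ltr_pdivrMr; lra.
- by have [x0 x1] := andP x01; field; lra.
- rewrite ltr_pdivrMr; last by lra.
  by rewrite mulrAC ltr_pdivlMr; lra.
have den_gt0 x : 0 < x ^+ 2 + (1 - x) ^+ 2.
  by rewrite !expr2; nra.
have [x x01|x x01|x x01|x y x0 xy y1|g [gs gE]] :=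
  @unit_interval_homeo (fun x => x ^+ 2 / (x ^+ 2 + (1 - x) ^+ 2))
    (fun x => Num.sqrt x / (Num.sqrt x + Num.sqrt (1 - x))).
- have [x0 x1] := andP x01.
  rewrite divr_gt0 ?exprn_gt0//= ltr_pdivrMr// mul1r ltrDl exprn_gt0//; lra.
- have [x0 x1] := andP x01.
  have s0 : 0 < Num.sqrt x by rewrite sqrtr_gt0.
  have t0 : 0 < Num.sqrt (1 - x) by rewrite sqrtr_gt0; lra.
  by rewrite divr_gt0 ?addr_gt0//= ltr_pdivrMr ?addr_gt0// mul1r ltrDl.
- have [x0 x1] := andP x01.
  have s0 : 0 < Num.sqrt x by rewrite sqrtr_gt0.
  have t0 : 0 < Num.sqrt (1 - x) by rewrite sqrtr_gt0; lra.
  have s2 : Num.sqrt x ^+ 2 = x by rewrite sqr_sqrtr// ltW.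
  have t2 : Num.sqrt (1 - x) ^+ 2 = 1 - x by rewrite sqr_sqrtr//; lra.
  move: s2 t2 s0 t0; move: (Num.sqrt x) (Num.sqrt (1 - x)) => s t s2 t2 s0 t0.
  have st : s ^+ 2 + t ^+ 2 = 1 by rewrite s2 t2; ring.
  have -> : x = s ^+ 2 / (s ^+ 2 + t ^+ 2) by rewrite st s2 divr1.
  field; rewrite st oner_neq0; apply/lt0r_neq0; lra.
- rewrite ltr_pdivrMr// mulrAC ltr_pdivlMr//.
  have : x * (1 - y) < y * (1 - x) by lra.
  have : 0 < x * (1 - y) by rewrite mulr_gt0//; lra.
  by rewrite !expr2; nra.
exists e, g; split => // [x x01|].
  have [x0 x1] := andP x01.
  by rewrite eE// ltr_pdivlMr; nra.
apply: homeo_plus_eq => x; rewrite !homeo_plus_mulE.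
have [x01|nx] := pselect (is_true (0 < x < 1)); last first.
  by rewrite (es x)// (gs x)// !(es x).
have ex01 : 0 < e x < 1 by apply/(supported_stable _ es).
have gx01 : 0 < g x < 1 by apply/(supported_stable _ gs).
have egx01 : 0 < e (g x) < 1 by apply/(supported_stable _ es).
rewrite (eE (e (g x)))// (eE (g x))// (gE (e x))// (eE x)// (gE x)//.
have [x0 x1] := andP x01; have := den_gt0 x; rewrite !expr2 => den.
by field; repeat (apply/andP; split); apply/lt0r_neq0; nra.
Qed.

Lemma periodic_copy f0 : supported (fun x => 0 < x < 1) f0 ->
  exists f, supported (@slots R) f /\
    forall m t, 0 < t < 1 -> f ((3 * m).+1%:R + t) = (3 * m).+1%:R + f0 t.
Proof.
move=> f0s.
have f00 : f0 0 = 0 by apply: f0s; rewrite ltxx.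
have f01 : f0 1 = 1 by apply: f0s; rewrite ltxx andbF.
have /choice[tau tauE] := fun c : R => translation_homeo c.
pose F k := if (k %% 3 == 1)%N then
  (tau k%:R * f0 * tau (- k%:R))%g else 1%g.
have FE k x : F k x = if (k %% 3 == 1)%N then f0 (x - k%:R) + k%:R else x.
  by rewrite /F; case: ifP => _ //; rewrite !homeo_plus_mulE !tauE.
have Fl k : F k k%:R = k%:R.
  by rewrite FE subrr f00 add0r if_same.
have Fr k : F k k.+1%:R = k.+1%:R.
  rewrite FE -natr1 [k%:R + 1]addrC addrK f01 if_same //.
have [k|z|f fE] := @glue_homeo R F.
- by rewrite Fl Fr.
- by exists (Num.truncn z).+1; rewrite Fl; exact/ltW/truncnS_gt.
exists f; split => [x nx|m t t01]; last first.
  have [t0 t1] := andP t01.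
  have xm : in_slot m ((3 * m).+1%:R + t).
    by apply/andP; split; rewrite -?[(3 * m).+2%:R]natr1 ?ltrD2l ?ltrDl.
  rewrite fE (in_slot_truncn xm) FE ifT; last by lia.
  by rewrite [_ + t]addrC addrK addrC.
rewrite fE FE; case: ifP => // k1.
have [x0|x0] := ltP x 0.
  move: k1; suff -> : Num.truncn x = 0%N by [].
  by apply/truncn0Pn; lra.
set k := Num.truncn x in k1 *.
have /andP[kx xk] := truncn_itv x0; rewrite -/k in kx xk.
rewrite f0s ?subrK// => /andP[lk rk]; apply: nx; exists (k %/ 3)%N.
have e1 : (3 * (k %/ 3)).+1 = k by lia.
by rewrite /in_slot !e1; apply/andP; split; lra.
Qed.

Lemma slots_self_commutator : exists e g : homeo_plus R,
  [/\ supported (@slots R) e, supported (@slots R) g,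
      forall x, slots x -> x < e x & (g * e * g^-1 * e^-1 = e)%g].
Proof.
have [e0 [g0 [e0s g0s e0x ge0]]] := unit_interval_self_commutator.
have [e [es eE]] := periodic_copy e0s; have [g [gs gE]] := periodic_copy g0s.
have slotP m x : in_slot m x ->
    exists2 t, 0 < t < 1 & x = (3 * m).+1%:R + t.
  move=> /andP[lx rx]; exists (x - (3 * m).+1%:R); last by rewrite addrC subrK.
  by rewrite subr_gt0 lx ltrBlDl natr1.
exists e, g; split => // [x [m /slotP[t t01 ->]]|].
  by rewrite eE// ltrD2l e0x.
suff ge : (g * e = e * e * g)%g by rewrite ge !mulgK.
apply: homeo_plus_eq => x; rewrite !homeo_plus_mulE.
have [[m /slotP[t t01 ->]]|nx] := pselect (slots x); last first.
  by rewrite (es x)// (gs x)// !(es x).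
have et01 : 0 < e0 t < 1 by apply/(supported_stable _ e0s).
have gt01 : 0 < g0 t < 1 by apply/(supported_stable _ g0s).
have egt01 : 0 < e0 (g0 t) < 1 by apply/(supported_stable _ e0s).
by rewrite !(eE, gE)// -!homeo_plus_mulE ge0.
Qed.

(** The slots have length 1 and period 3; open intervals of this kind need four
    translates to cover without missing endpoints. *)
Lemma slot_translates_cover x : 4 <= x ->
  [\/ slots x, slots (x - 3 / 4), slots (x - 3 / 2) | slots (x - 9 / 4)].
Proof.
move=> x4; have x1 : 0 <= x - 1 by lra.
have /andP[kl kr] := truncn_itv x1; set k := Num.truncn _ in kl kr.
have k3 : (3 <= k)%N by rewrite truncn_ge_nat//; lra.
have [i /andP[ik ki]] : exists i, (3 * i.+1 <= k < 3 * i.+2)%N.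
  by exists (k %/ 3).-1; lia.
have il : (3 * i.+1)%:R <= x - 1 by apply: le_trans kl; rewrite ler_nat.
have ir : x - 1 < (3 * i.+2)%:R.
  by apply: lt_le_trans kr _; rewrite ler_nat.
have slotI y n : n%:R * 3 + 1 < y -> y < n%:R * 3 + 2 -> slots y.
  move=> ny yn; exists n; apply/andP; split.
    by rewrite -natr1 natrM mulrC.
  by rewrite -2!natr1 natrM mulrC -addrA.
rewrite !natrM -?[i.+2%:R]natr1 -[i.+1%:R]natr1 in il ir.
have [r1|r1] := ltP (x - 1) (i%:R * 3 + 13 / 4).
  by apply: Or44; apply: (slotI _ i); lra.
have [r2|r2] := ltP (x - 1) (i%:R * 3 + 4).
  by apply: Or41; apply: (slotI _ i.+1); rewrite -[i.+1%:R]natr1; lra.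
have [r3|r3] := ltP (x - 1) (i%:R * 3 + 19 / 4).
  by apply: Or42; apply: (slotI _ i.+1); rewrite -[i.+1%:R]natr1; lra.
have [r4|r4] := ltP (x - 1) (i%:R * 3 + 11 / 2).
  by apply: Or43; apply: (slotI _ i.+1); rewrite -[i.+1%:R]natr1; lra.
by apply: Or44; apply: (slotI _ i.+1); rewrite -[i.+1%:R]natr1; lra.
Qed.

Lemma eventually_above_of_translates e :
    supported (@slots R) e -> (forall x, slots x -> x < e x) ->
  exists a b c d : homeo_plus R,
    eventually_above (e ^ a * (e ^ b * (e ^ c * e ^ d)))%g.
Proof.
move=> es ex.
have /choice[tau tauE] := fun c : R => translation_homeo (- c).
have e_ge x : x <= e x.
  by have [/ex/ltW//|ns] := pselect (slots x); rewrite es.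
pose T c := (e ^ tau c)%g.
have TE c x : T c x = e (x - c) + c.
  rewrite /T conjgE !homeo_plus_mulE tauE; apply: (canLR (homeoVK _)).
  by rewrite tauE addrK.
have T_ge c x : x <= T c x by rewrite TE; have := e_ge (x - c); lra.
have T_gt c x : slots (x - c) -> x < T c x.
  by move=> /ex; rewrite TE; lra.
exists (tau 0), (tau (3 / 4)), (tau (3 / 2)), (tau (9 / 4)).
exists 4 => x /slot_translates_cover cover.
rewrite -/(T 0) -/(T (3 / 4)) -/(T (3 / 2)) -/(T (9 / 4)).
rewrite !homeo_plus_mulE.
have T_mono c y z : y <= z -> T c y <= T c z by rewrite homeo_le.
case: cover => [s|s|s|s].
- apply: (@lt_le_trans _ _ (T 0 x)); first by apply: T_gt; rewrite subr0.
  by apply: T_mono; do 2! apply: le_trans (T_ge _ _); exact: T_ge.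
- apply: lt_le_trans (T_ge _ _); apply: lt_le_trans (T_gt _ _ s) _.
  by apply: T_mono; apply: le_trans (T_ge _ _); exact: T_ge.
- do 2! apply: lt_le_trans (T_ge _ _).
  by apply: lt_le_trans (T_gt _ _ s) _; apply: T_mono; exact: T_ge.
- by do 3! apply: lt_le_trans (T_ge _ _); exact: T_gt.
Qed.

End SelfCommutator.

Theorem theorem1p4 (R : realType)
  (phi : {multiplicative germ_infty R -> homeo_plus R}) :
  forall a : germ_infty R, phi a = 1%g.
Proof.
have [e [g [es gs ex ge]]] := slots_self_commutator R.
have phie : phi (germ_of e) = 1%g.
  apply: (@small_products_trivial _ _ _ 10) => // chi.
    by rewrite -ge; exact: commutator_quotient_product.
  have -> : ((germ_of e)^-1 = germ_of (e * g * e^-1 * g^-1))%g.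
    by rewrite -gmulfV -{1}ge !invgM !invgK !mulgA.
  exact: commutator_quotient_product.
have [a [b [c [d above]]]] := eventually_above_of_translates es ex.
apply: (eventually_above_trivial above).
have conj_e h : phi (germ_of (e ^ h)%g) = 1%g.
  by rewrite conjgE !gmulfM phie mul1g -!gmulfM mulVg !gmulf1 multiplicative1.
by do 3! rewrite gmulfM gmulfM conj_e mul1g; exact: conj_e.
Qed.
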